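(* Let $\widetilde M=(\mathbb{R}^2,dt^2+f(t)^2d\theta^2)$ be a non-compact model surface of revolution admitting a finite total curvature $c(\widetilde M)<2\pi$, and let $K(t):=-f''(t)/f(t)$. Then for every $\varepsilon>0$ there exists a non-compact model surface of revolution $\widetilde M_\varepsilon^-=(\mathbb{R}^2,dt^2+m_\varepsilon^-(t)^2d\theta^2)$, with radial curvature $G_\varepsilon^-(t):=-m_\varepsilon^{-\,\prime\prime}(t)/m_\varepsilon^-(t)$, admitting a finite total curvature, such that $K\ge G_\varepsilon^-$ on $[0,\infty)$, $\|G_\varepsilon^--K\|_2:=\sqrt{\int_0^\infty|G_\varepsilon^--K|^2dt}<\varepsilon$, $\liminf_{t\to\infty}G_\varepsilon^-(t)=-\infty$, and $|c(\widetilde M)-c(\widetilde M_\varepsilon^-)|<\varepsilon$.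
   Context: A non-compact model surface of revolution is $\mathbb{R}^2$ with the metric $dt^2+m(t)^2d\theta^2$, where $(t,\theta)$ are polar coordinates about the origin and $m:(0,\infty)\to(0,\infty)$ is smooth, extends to a smooth odd function around $0$, and satisfies $m'(0)=1$. Its Gauss (radial) curvature is $-m''(t)/m(t)$. The total curvature of such a surface with Gauss curvature $G$ is $c:=\int G_+\,dA+\int G_-\,dA$ with $G_\pm$ the positive/negative parts ($G_+=\max\{G,0\}$, $G_-=\min\{G,0\}$) and $dA$ the area element; it is finite if both integrals are finite. *)

(* Defs.v *)
From Stdlib Require Import Reals.
Open Scope R_scope.

(* D is a "derivative tower": D 0 = m, and D (n+1) is the derivative of D n
   everywhere on R.  Existence of such a tower = m is smooth (C^infty) on R. *)
Definition deriv_tower (D : nat -> R -> R) : Prop :=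
  forall (n : nat) (x : R), derivable_pt_lim (D n) x (D (S n) x).

(* Non-compact model surface of revolution (R^2, dt^2 + m(t)^2 dtheta^2):
   m = D 0 is a smooth odd function on R, positive on (0,oo), with m'(0) = 1. *)
Definition is_model (D : nat -> R -> R) : Prop :=
  deriv_tower D /\
  (forall t, D 0%nat (- t) = - D 0%nat t) /\
  (forall t, 0 < t -> 0 < D 0%nat t) /\
  D 1%nat 0 = 1.

(* Radial (Gauss) curvature G(t) = - m''(t) / m(t), extended by continuity
   at t = 0, where its limit is - m'''(0) / m'(0) = - m'''(0). *)
Definition radial_curv (D : nat -> R -> R) (t : R) : R :=
  if Req_EM_T t 0 then - D 3%nat 0 else - D 2%nat t / D 0%nat t.

Definition improper_int0 (f : R -> R) (l : R) : Prop :=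
  (forall b, 0 <= b -> exists pr : Riemann_integrable f 0 b, True) /\
  (forall eps, 0 < eps -> exists B, forall b (pr : Riemann_integrable f 0 b),
      B <= b -> Rabs (RiemannInt pr - l) < eps).

(* The surface with profile D has FINITE total curvature c:
   c = int G_+ dA + int G_- dA, with dA = m(t) dt dtheta, both integrals finite. *)
Definition total_curvature (D : nat -> R -> R) (c : R) : Prop :=
  exists a b : R,
    improper_int0 (fun t => Rmax (radial_curv D t) 0 * D 0%nat t) a /\
    improper_int0 (fun t => Rmin (radial_curv D t) 0 * D 0%nat t) b /\
    c = 2 * PI * a + 2 * PI * b.

(* Main.v *)
Require Import Defs.
From Stdlib Require Import Reals ZArith Lra Lia.
From Coquelicot Require Import Coquelicot.
Open Scope R_scope.

(** Write m = f u.  Then m''/m - f''/f = (f^2 u')' / (f^2 u), so choosing a smooth phi >= 0 that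
    vanishes near 0 and solving (f^2 u')' = phi with u = 1 near 0 lowers the curvature by exactly
    phi / (f^2 u).  Finite total curvature c < 2 pi means f'(oo) = 1 - c / 2 pi > 0, hence f grows
    linearly and u stays within O(int phi) of 1.  Taking for phi a train of spikes, tall enough to
    beat f^2 (|K| + n) at the n-th spike but so thin that int phi and int phi^2 are small, gives
    unbounded curvature, a small L^2 perturbation, and m'' = f'' u + phi / f close to f'' in L^1. *)

(** * Smooth functions on the line *)

(** The obstacle is a circularity: the spikes must be tall relative to f^2 u, but u is built from
    the spikes. It is broken by fixing the total mass eta first. Given the linear growth of f, a
    small mass alone forces 1 <= u <= 2, so heights 2 f^2 (|K| + n) are enough, and the widths are
    cut down afterwards to respect eta. Every smallness requirement thereby becomes an upper bound
    on the single number eta. The spikes are functions of t^2. This makes phi and u even, hence f u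
    odd, as a model surface demands. As phi vanishes for t^2 <= 1, the new profile has the same germ
    at 0 as f, which settles both m'(0) = 1 and the curvature at the origin. Total curvature is
    handled through second derivatives only: multiplying by dA cancels the profile, and the positive
    part is 1-Lipschitz, so L^1 closeness of m'' and f'' controls the two curvature integrals
    separately. *)

Fixpoint ndiff (n : nat) (f : R -> R) : Prop :=
  match n with
  | O => True
  | S n => (forall x, ex_derive f x) /\ ndiff n (Derive f)
  end.

Definition smooth (f : R -> R) : Prop := forall n, ndiff n f.

(** Derivatives depend only on germs, so a different model [g] may be used around each point. This
    is what makes an infinite train smooth: near any point it coincides with a finite one. *)
Lemma ndiff_loc n : forall f : R -> R,
  (forall x, exists g, ndiff n g /\ locally x (fun y => g y = f y)) -> ndiff n f.
Proof.
  induction n as [|n IH]; intros f H; simpl; [exact I|].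
  split.
  - intros x; destruct (H x) as [g [[Hg _] Hl]].
    now apply ex_derive_ext_loc with g.
  - apply IH; intros x; destruct (H x) as [g [[_ Hg] Hl]].
    exists (Derive g); split; [exact Hg|].
    apply locally_locally in Hl.
    apply filter_imp with (2 := Hl); intros y Hy.
    now apply Derive_ext_loc.
Qed.

Lemma ndiff_ext n (f g : R -> R) : (forall x, f x = g x) -> ndiff n f -> ndiff n g.
Proof.
  intros E H; apply ndiff_loc; intros x; exists f; split; [exact H|].
  now apply filter_forall.
Qed.

Lemma smooth_ext (f g : R -> R) : (forall x, f x = g x) -> smooth f -> smooth g.
Proof. intros E H n; now apply ndiff_ext with f. Qed.

Lemma ndiff_derive n (f f' : R -> R) :
  (forall x, is_derive f x (f' x)) -> ndiff n f' -> ndiff (S n) f.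
Proof.
  intros D H; split.
  - intros x; now exists (f' x).
  - apply ndiff_ext with f'; [|exact H].
    intros x; symmetry; now apply is_derive_unique.
Qed.

Lemma ndiff_pred n : forall f : R -> R, ndiff (S n) f -> ndiff n f.
Proof.
  induction n as [|n IH]; intros f H; [exact I|].
  destruct H as [H1 H2]; split; [exact H1|now apply IH].
Qed.

Lemma smooth_is_derive (f : R -> R) (x : R) : smooth f -> is_derive f x (Derive f x).
Proof. intros H; apply Derive_correct, (proj1 (H 1%nat)). Qed.

Lemma smooth_Derive (f : R -> R) : smooth f -> smooth (Derive f).
Proof. intros H n; exact (proj2 (H (S n))). Qed.

Lemma smooth_continuous (f : R -> R) (x : R) : smooth f -> continuous f x.
Proof. intros H; apply (@ex_derive_continuous R_AbsRing R_NormedModule), (proj1 (H 1%nat)). Qed.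

Lemma smooth_ex_RInt (f : R -> R) a b : smooth f -> ex_RInt f a b.
Proof. intros H; apply (@ex_RInt_continuous R_CompleteNormedModule); intros; now apply smooth_continuous. Qed.

Lemma ndiff_const n : forall c : R, ndiff n (fun _ => c).
Proof.
  induction n as [|n IH]; intros c; [exact I|].
  apply ndiff_derive with (fun _ => 0); [|apply IH].
  intros x; apply (@is_derive_const R_AbsRing R_NormedModule).
Qed.

Lemma smooth_const c : smooth (fun _ => c).
Proof. intros n; apply ndiff_const. Qed.

Lemma smooth_id : smooth (fun x => x).
Proof.
  intros [|n]; [exact I|].
  apply ndiff_derive with (fun _ => 1); [|apply ndiff_const].
  intros x; apply (@is_derive_id R_AbsRing).
Qed.

Lemma ndiff_plus n : forall f g : R -> R,
  ndiff n f -> ndiff n g -> ndiff n (fun x => f x + g x).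
Proof.
  induction n as [|n IH]; intros f g Hf Hg; [exact I|].
  destruct Hf as [Hf Hf'], Hg as [Hg Hg'].
  apply ndiff_derive with (fun x => Derive f x + Derive g x); [|now apply IH].
  intros x; apply (@is_derive_plus R_AbsRing R_NormedModule); now apply Derive_correct.
Qed.

Lemma smooth_plus f g : smooth f -> smooth g -> smooth (fun x => f x + g x).
Proof. intros Hf Hg n; now apply ndiff_plus. Qed.

Lemma ndiff_mult n : forall f g : R -> R,
  ndiff n f -> ndiff n g -> ndiff n (fun x => f x * g x).
Proof.
  induction n as [|n IH]; intros f g Hf Hg; [exact I|].
  assert (Hf0 := ndiff_pred _ _ Hf); assert (Hg0 := ndiff_pred _ _ Hg).
  destruct Hf as [Hf Hf'], Hg as [Hg Hg'].
  apply ndiff_derive with (fun x => Derive f x * g x + f x * Derive g x).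
  - intros x; apply (is_derive_mult f g); try now apply Derive_correct.
    intros a b; apply Rmult_comm.
  - apply ndiff_plus; now apply IH.
Qed.

Lemma smooth_mult f g : smooth f -> smooth g -> smooth (fun x => f x * g x).
Proof. intros Hf Hg n; now apply ndiff_mult. Qed.

Lemma smooth_minus f g : smooth f -> smooth g -> smooth (fun x => f x - g x).
Proof.
  intros Hf Hg.
  apply smooth_ext with (fun x => f x + (-1) * g x); [intros; ring|].
  apply smooth_plus; [exact Hf|apply smooth_mult; [apply smooth_const|exact Hg]].
Qed.

(** The derivative -g' (1/g)^2 is again a product involving 1/g, so the induction hypothesis on 1/g
    itself closes the step. *)
Lemma smooth_inv g : (forall x, g x <> 0) -> smooth g -> smooth (fun x => / g x).
Proof.
  intros Hne Hg n; induction n as [|n IH]; [exact I|].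
  apply ndiff_derive with (fun x => (-1) * Derive g x * (/ g x * / g x)).
  - intros x; replace ((-1) * Derive g x * (/ g x * / g x))
      with (- Derive g x / g x ^ 2) by (field; apply Hne).
    apply is_derive_inv; [now apply smooth_is_derive|apply Hne].
  - apply ndiff_mult; apply ndiff_mult; auto using ndiff_const.
    now apply smooth_Derive.
Qed.

Lemma smooth_comp f g : smooth f -> smooth g -> smooth (fun x => f (g x)).
Proof.
  intros Hf Hg n; revert f Hf; induction n as [|n IH]; intros f Hf; [exact I|].
  apply ndiff_derive with (fun x => Derive g x * Derive f (g x)).
  - intros x; apply (is_derive_comp f g); now apply smooth_is_derive.
  - apply ndiff_mult; [now apply smooth_Derive|].
    apply IH; now apply smooth_Derive.
Qed.

Lemma smooth_is_derive_RInt f x : smooth f -> is_derive (RInt f 0) x (f x).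
Proof.
  intros Hf; apply is_derive_RInt with 0.
  - apply filter_forall; intros y; apply (@RInt_correct R_CompleteNormedModule).
    now apply smooth_ex_RInt.
  - now apply smooth_continuous.
Qed.

Lemma smooth_RInt f : smooth f -> smooth (RInt f 0).
Proof.
  intros Hf [|n]; [exact I|].
  apply ndiff_derive with f; [|apply Hf].
  intros x; now apply smooth_is_derive_RInt.
Qed.

Lemma deriv_tower_smooth D k : deriv_tower D -> smooth (D k).
Proof.
  intros HD n; revert k; induction n as [|n IH]; intros k; [exact I|].
  apply ndiff_derive with (D (S k)); [|apply IH].
  intros x; apply is_derive_Reals, HD.
Qed.

Lemma smooth_Derive_n f n : smooth f -> smooth (Derive_n f n).
Proof.
  intros Hf; induction n as [|n IH]; [exact Hf|].
  now apply (smooth_Derive (Derive_n f n)).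
Qed.

Lemma smooth_deriv_tower f : smooth f -> deriv_tower (Derive_n f).
Proof.
  intros Hf n x; apply is_derive_Reals; simpl.
  now apply smooth_is_derive, smooth_Derive_n.
Qed.

Lemma deriv_tower_Derive_n D n x : deriv_tower D -> Derive_n (D 0%nat) n x = D n x.
Proof.
  intros HD; revert x; induction n as [|n IH]; intros x; [reflexivity|].
  simpl; rewrite (Derive_ext _ _ x IH).
  apply is_derive_unique, is_derive_Reals, HD.
Qed.

(** * Flat functions and bumps *)

(** The whole family x^(-k) e^(-1/x) is taken, rather than k = 0 alone, because its span is closed
    under differentiation; smoothness is then an induction. *)
Definition flat (k : nat) (x : R) : R :=
  if Rlt_dec 0 x then (/ x) ^ k * exp (- / x) else 0.

Lemma flat_pos k x : 0 < x -> flat k x = (/ x) ^ k * exp (- / x).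
Proof. intros H; unfold flat; destruct (Rlt_dec 0 x); [reflexivity|lra]. Qed.

Lemma flat_neg k x : x <= 0 -> flat k x = 0.
Proof. intros H; unfold flat; destruct (Rlt_dec 0 x); [lra|reflexivity]. Qed.

Lemma exp_INR_mult n x : exp (INR n * x) = exp x ^ n.
Proof.
  induction n as [|n IH]; [simpl; now rewrite Rmult_0_l, exp_0|].
  rewrite S_INR, Rmult_plus_distr_r, Rmult_1_l, exp_plus, IH; simpl; ring.
Qed.

(** Raise z <= e^z, for z = y / (n + 1), to the power n + 1. *)
Lemma pow_le_exp n y : 0 <= y -> y ^ S n <= INR (S n) ^ S n * exp y.
Proof.
  intros Hy.
  assert (Hn : 0 < INR (S n)) by (apply lt_0_INR; lia).
  replace (exp y) with (exp (y / INR (S n)) ^ S n)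
    by (rewrite <- exp_INR_mult; f_equal; field; lra).
  rewrite <- Rpow_mult_distr; apply pow_incr; split; [exact Hy|].
  assert (H := exp_ineq1_le (y / INR (S n))).
  replace y with (INR (S n) * (y / INR (S n))) at 1 by (field; lra).
  apply Rmult_le_compat_l; lra.
Qed.

Lemma flat_bound k x : 0 < x -> 0 < flat k x <= INR (S k) ^ S k * x.
Proof.
  intros Hx; rewrite flat_pos by exact Hx.
  assert (Hi : 0 < / x) by now apply Rinv_0_lt_compat.
  split; [apply Rmult_lt_0_compat; [now apply pow_lt|apply exp_pos]|].
  assert (H := pow_le_exp k (/ x) (Rlt_le _ _ Hi)).
  assert (He := exp_pos (- / x)).
  assert (E : exp (/ x) * exp (- / x) = 1)
    by (rewrite <- exp_plus, Rplus_opp_r; apply exp_0).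
  replace ((/ x) ^ k * exp (- / x)) with ((/ x) ^ S k * (x * exp (- / x)))
    by (simpl; field; lra).
  apply Rle_trans with (INR (S k) ^ S k * exp (/ x) * (x * exp (- / x))).
  - apply Rmult_le_compat_r; [apply Rmult_le_pos; lra|exact H].
  - apply Req_le.
    transitivity (INR (S k) ^ S k * x * (exp (/ x) * exp (- / x))); [ring|].
    rewrite E; ring.
Qed.

(** Only x = 0 is delicate. There the right difference quotient of [flat k] is [flat (S k)], which
    the linear bound [flat_bound] sends to 0. *)
Lemma is_derive_flat k x :
  is_derive (flat k) x (flat (S (S k)) x - INR k * flat (S k) x).
Proof.
  destruct (Rtotal_order x 0) as [Hx|[Hx|Hx]].
  - rewrite !flat_neg by lra.
    apply is_derive_ext_loc with (fun _ => 0).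
    + apply locally_interval with m_infty 0; simpl; trivial.
      intros y _ Hy; symmetry; apply flat_neg; lra.
    + replace (0 - INR k * 0) with 0 by ring.
      apply (@is_derive_const R_AbsRing R_NormedModule).
  - subst x; rewrite !(flat_neg _ 0) by lra.
    apply is_derive_Reals; intros eps Heps.
    set (C := INR (S (S k)) ^ S (S k)).
    assert (HC : 0 < C) by (apply pow_lt, lt_0_INR; lia).
    assert (Hd : 0 < eps / C) by now apply Rdiv_lt_0_compat.
    exists (mkposreal _ Hd); intros h Hh0 Hh; simpl in Hh.
    rewrite Rplus_0_l, (flat_neg k 0) by lra.
    destruct (Rlt_or_le 0 h) as [Hp|Hn].
    + replace ((flat k h - 0) / h - (0 - INR k * 0)) with (flat (S k) h)
        by (rewrite !flat_pos by exact Hp; simpl; field; lra).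
      destruct (flat_bound (S k) h Hp) as [H1 H2]; fold C in H2.
      rewrite Rabs_pos_eq in Hh |- * by lra.
      apply Rle_lt_trans with (1 := H2).
      replace eps with (C * (eps / C)) by (field; lra).
      now apply Rmult_lt_compat_l.
    + rewrite flat_neg by exact Hn.
      replace ((0 - 0) / h - (0 - INR k * 0)) with 0 by (field; exact Hh0).
      now rewrite Rabs_R0.
  - apply is_derive_ext_loc with (fun y => (/ y) ^ k * exp (- / y)).
    + apply locally_interval with 0 p_infty; simpl; trivial.
      intros y Hy _; symmetry; now apply flat_pos.
    + rewrite !flat_pos by exact Hx.
      auto_derive; [lra|].
      destruct k as [|k]; simpl pred; [simpl; field; lra|].
      rewrite S_INR; simpl pow; field; lra.
Qed.

Lemma smooth_flat k : smooth (flat k).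
Proof.
  intros n; revert k; induction n as [|n IH]; intros k; [exact I|].
  apply ndiff_derive with (fun x => flat (S (S k)) x + (- INR k) * flat (S k) x).
  - intros x; replace (flat (S (S k)) x + - INR k * flat (S k) x)
      with (flat (S (S k)) x - INR k * flat (S k) x) by ring.
    apply is_derive_flat.
  - apply ndiff_plus; [apply IH|apply ndiff_mult; [apply ndiff_const|apply IH]].
Qed.

Definition bump (x : R) : R := exp 1 * flat 0 (1 - x * x).

Lemma smooth_bump : smooth bump.
Proof.
  apply smooth_mult; [apply smooth_const|].
  apply (smooth_comp (flat 0)); [apply smooth_flat|].
  apply smooth_minus; [apply smooth_const|apply smooth_mult; apply smooth_id].
Qed.

Lemma bump_out x : 1 <= x * x -> bump x = 0.
Proof. intros H; unfold bump; rewrite flat_neg by lra; ring. Qed.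

Lemma bump_0 : bump 0 = 1.
Proof.
  unfold bump; rewrite flat_pos by lra.
  replace (1 - 0 * 0) with 1 by ring.
  rewrite Rinv_1, pow_O, Rmult_1_l, <- exp_plus, Rplus_opp_r; apply exp_0.
Qed.

(** Inside the support bump <= 1 <= 2 / (1 + x^2). The Cauchy profile is chosen as majorant because
    its primitive is explicit, so no integral has to be split along supports. *)
Lemma bump_bound x : 0 <= bump x <= 2 / (1 + x * x).
Proof.
  assert (Hq : 0 <= x * x) by nra.
  assert (H2 : 0 < 2 / (1 + x * x)) by (apply Rdiv_lt_0_compat; lra).
  destruct (Rle_or_lt 1 (x * x)) as [H|H]; [rewrite bump_out; lra|].
  unfold bump; rewrite flat_pos by lra.
  rewrite pow_O, Rmult_1_l, <- exp_plus.
  split; [apply Rlt_le, exp_pos|].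
  apply Rle_trans with (exp 0).
  - destruct (Req_dec (1 + - / (1 - x * x)) 0) as [->|N]; [lra|].
    apply Rlt_le, exp_increasing.
    assert (1 <= / (1 - x * x)); [|lra].
    rewrite <- Rinv_1; apply Rinv_le_contravar; lra.
  - rewrite exp_0; apply Rmult_le_reg_r with (1 + x * x); [lra|].
    unfold Rdiv; rewrite Rmult_assoc, Rinv_l; lra.
Qed.

(** * Spikes in the variable t^2 and their masses *)

Definition spike (h s d t : R) : R := h * bump ((t * t - s) / d).

Lemma smooth_spike h s d : smooth (spike h s d).
Proof.
  apply smooth_mult; [apply smooth_const|].
  apply (smooth_comp bump); [apply smooth_bump|].
  apply (smooth_mult (fun t => t * t - s) (fun _ => / d)); [|apply smooth_const].
  apply smooth_minus; [|apply smooth_const].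
  apply smooth_mult; apply smooth_id.
Qed.

Lemma spike_ge0 h s d t : 0 <= h -> 0 <= spike h s d t.
Proof. intros Hh; apply Rmult_le_pos; [exact Hh|apply bump_bound]. Qed.

Lemma spike_out h s d t : 0 < d -> d <= Rabs (t * t - s) -> spike h s d t = 0.
Proof.
  intros Hd H; unfold spike; rewrite bump_out; [ring|].
  replace ((t * t - s) / d * ((t * t - s) / d)) with (Rsqr (Rabs (t * t - s) / d)).
  - rewrite <- Rsqr_1; apply Rsqr_incr_1; [|lra|].
    + apply Rmult_le_reg_r with d; [exact Hd|].
      unfold Rdiv; rewrite Rmult_assoc, Rinv_l; lra.
    + apply Rle_div_r; [exact Hd|]. rewrite Rmult_0_l; apply Rabs_pos.
  - rewrite Rsqr_div', <- Rsqr_abs; unfold Rsqr; field; lra.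
Qed.

(** The derivative of 2 d atan((t^2 - s) / d): the Cauchy majorant of the bump times the Jacobian 2
    t of t^2. *)
Definition kernel (s d t : R) : R := 4 * t / (1 + (t * t - s) / d * ((t * t - s) / d)).

Lemma one_plus_sqr_pos x : 0 < 1 + x * x.
Proof. nra. Qed.

Lemma is_RInt_kernel s d b : 0 < d ->
  is_RInt (kernel s d) 0 b
    (2 * d * atan ((b * b - s) / d) - 2 * d * atan ((0 * 0 - s) / d)).
Proof.
  intros Hd.
  apply (is_RInt_derive (fun t => 2 * d * atan ((t * t - s) / d)) (kernel s d)).
  - intros x _; unfold kernel.
    assert (H := one_plus_sqr_pos ((x * x - s) / d)).
    auto_derive; [lra|].
    unfold Rsqr; simpl; field.
    assert (0 < d * d) by nra.
    assert (0 <= (x * x - s) * (x * x - s)) by apply Rle_0_sqr.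
    split; lra.
  - intros x _; apply (@ex_derive_continuous R_AbsRing R_NormedModule).
    unfold kernel; assert (H := one_plus_sqr_pos ((x * x - s) / d)).
    auto_derive; repeat split; lra.
Qed.

(** An increment of atan is below pi <= 4, so the kernel has mass at most 8 d, whatever its centre
    and the endpoint [b]. *)
Lemma RInt_le_kernel F q s d b : 0 < d -> 0 <= q -> 0 <= b -> smooth F ->
  (forall t, 0 <= t -> F t <= q * kernel s d t) -> RInt F 0 b <= 8 * q * d.
Proof.
  intros Hd Hq Hb HF H.
  assert (HK := is_RInt_kernel s d b Hd).
  apply (is_RInt_scal _ 0 b q) in HK.
  assert (HI : RInt (fun t => q * kernel s d t) 0 b
    = q * (2 * d * atan ((b * b - s) / d) - 2 * d * atan ((0 * 0 - s) / d)))
    by exact (is_RInt_unique _ _ _ _ HK).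
  apply Rle_trans with (RInt (fun t => q * kernel s d t) 0 b).
  - apply RInt_le; [exact Hb|now apply smooth_ex_RInt|eexists; exact HK|].
    intros x Hx; apply H; lra.
  - rewrite HI.
    assert (B1 := atan_bound ((b * b - s) / d)).
    assert (B2 := atan_bound ((0 * 0 - s) / d)).
    assert (HP := PI_4).
    replace (8 * q * d) with (q * (2 * d * 4)) by ring.
    apply Rmult_le_compat_l; [exact Hq|].
    rewrite <- Rmult_minus_distr_l; apply Rmult_le_compat_l; lra.
Qed.

(* The spike lives in t >= 1, where dt <= 2 t dt = d(t^2): the Cauchy kernel in t^2 dominates. *)
Lemma spike_le_kernel h s d t :
  0 <= h -> 0 < d -> d + 1 <= s -> 0 <= t -> spike h s d t <= h * kernel s d t.
Proof.
  intros Hh Hd Hs Ht.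
  assert (HD := one_plus_sqr_pos ((t * t - s) / d)).
  assert (Hi := Rinv_0_lt_compat _ HD).
  destruct (Rle_or_lt d (Rabs (t * t - s))) as [H|H].
  - rewrite spike_out by assumption.
    apply Rmult_le_pos; [exact Hh|]; unfold kernel, Rdiv.
    apply Rmult_le_pos; lra.
  - apply Rmult_le_compat_l; [exact Hh|].
    apply Rabs_def2 in H.
    apply Rle_trans with (1 := proj2 (bump_bound _)); unfold kernel, Rdiv at 1 4.
    apply Rmult_le_compat_r; [now apply Rlt_le|nra].
Qed.

Lemma spike_sqr_le_kernel h s d t :
  0 <= h -> 0 < d -> d + 1 <= s -> 0 <= t ->
  spike h s d t * spike h s d t <= 2 * h * h * kernel s d t.
Proof.
  intros Hh Hd Hs Ht.
  assert (H := spike_le_kernel h s d t Hh Hd Hs Ht).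
  assert (H0 := spike_ge0 h s d t Hh).
  assert (H2 : spike h s d t <= h * 2).
  { apply Rmult_le_compat_l; [exact Hh|].
    apply Rle_trans with (1 := proj2 (bump_bound _)).
    set (x := (t * t - s) / d).
    apply Rmult_le_reg_r with (1 + x * x); [nra|].
    unfold Rdiv; rewrite Rmult_assoc, Rinv_l; nra. }
  apply Rle_trans with (h * 2 * (h * kernel s d t)); [|lra].
  now apply Rmult_le_compat.
Qed.

(** * Trains of spikes with disjoint supports *)

Definition width (eta : R) (h : nat -> R) (n : nat) : R :=
  eta / (2 * eta + 16 * 2 ^ S n * (h n + h n * h n)).

Fixpoint train (eta : R) (h : nat -> R) (N : nat) (t : R) : R :=
  match N with
  | O => 0
  | S n => train eta h n t + spike (h n) (INR n + 2) (width eta h n) t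
  end.

(** The two terms in the denominator of [width] serve two purposes: 2 eta forces d <= 1/2, which
    separates spikes whose centres are 1 apart in t^2; the other makes the masses geometric. The
    factor 16 covers both 8 h d, for the spike, and 16 h^2 d, for its square. *)
Lemma width_bounds eta h n : 0 < eta -> 0 <= h n ->
  0 < width eta h n <= / 2 /\
  16 * (h n + h n * h n) * width eta h n <= eta * (/ 2) ^ S n.
Proof.
  intros He Hh; unfold width.
  set (p := 2 ^ S n); assert (Hp : 0 < p) by (apply pow_lt; lra).
  set (q := h n + h n * h n); assert (Hq : 0 <= q) by (unfold q; nra).
  assert (Hpq : 0 <= p * q) by (apply Rmult_le_pos; lra).
  set (D := 2 * eta + 16 * p * q).
  assert (HD : 0 < D) by (unfold D; lra).
  repeat split.
  - now apply Rdiv_lt_0_compat.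
  - apply Rmult_le_reg_r with D; [exact HD|].
    unfold Rdiv; rewrite Rmult_assoc, Rinv_l by lra; unfold D; lra.
  - rewrite pow_inv; fold p.
    apply Rmult_le_reg_r with (D * p); [now apply Rmult_lt_0_compat|].
    replace (16 * q * (eta / D) * (D * p)) with (eta * (16 * p * q)) by (field; lra).
    replace (eta * / p * (D * p)) with (eta * D) by (field; lra).
    apply Rmult_le_compat_l; unfold D; lra.
Qed.

Lemma smooth_train eta h N : smooth (train eta h N).
Proof.
  induction N as [|N IH]; [apply (smooth_const 0)|].
  apply (smooth_plus (train eta h N)); [exact IH|apply smooth_spike].
Qed.

Lemma train_ge0 eta h N t : (forall n, 0 <= h n) -> 0 <= train eta h N t.
Proof.
  intros Hh; induction N as [|N IH]; simpl; [lra|].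
  assert (H := spike_ge0 (h N) (INR N + 2) (width eta h N) t (Hh N)); lra.
Qed.

(** The centres are t^2 = 2, ..., N + 1 and the half-widths at most 1/2, so the supports lie between
    t^2 = 3/2 and t^2 = N + 3/2. *)
Lemma train_out eta h N t : 0 < eta -> (forall n, 0 <= h n) ->
  t * t <= 1 \/ INR N + 3 / 2 <= t * t -> train eta h N t = 0.
Proof.
  intros He Hh; induction N as [|N IH]; intros H; [reflexivity|].
  rewrite S_INR in H; simpl train.
  assert (HN := pos_INR N).
  destruct (width_bounds eta h N He (Hh N)) as [[Hd1 Hd2] _].
  rewrite IH, spike_out; try lra.
  unfold Rabs; destruct (Rcase_abs _); lra.
Qed.

Lemma train_orth eta h N t : 0 < eta -> (forall n, 0 <= h n) ->
  train eta h N t * spike (h N) (INR N + 2) (width eta h N) t = 0.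
Proof.
  intros He Hh.
  destruct (Rle_or_lt (INR N + 3 / 2) (t * t)) as [H|H].
  - rewrite train_out; auto; ring.
  - destruct (width_bounds eta h N He (Hh N)) as [[Hd1 Hd2] _].
    rewrite spike_out; try lra.
    unfold Rabs; destruct (Rcase_abs _); lra.
Qed.

(** Spikes of index N and above are centred at t^2 >= N + 2, out of reach. Hence the infinite sum
    needs no theory of series. *)
Lemma train_stable eta h N k t : 0 < eta -> (forall n, 0 <= h n) ->
  t * t <= INR N -> train eta h (k + N) t = train eta h N t.
Proof.
  intros He Hh HN; induction k as [|k IH]; [reflexivity|]; simpl.
  destruct (width_bounds eta h (k + N) He (Hh _)) as [[Hd1 Hd2] _].
  rewrite IH, spike_out; try lra.
  rewrite plus_INR; assert (Hk := pos_INR k).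
  unfold Rabs; destruct (Rcase_abs _); lra.
Qed.

Lemma RInt_eq0 (f : R -> R) a b :
  (forall x, Rmin a b < x < Rmax a b -> f x = 0) -> RInt f a b = 0.
Proof.
  intros H; rewrite (RInt_ext f (fun _ => 0)) by exact H.
  rewrite RInt_const; apply Rmult_0_r.
Qed.

(** Sum the masses eta 2^(-n-1). By disjointness of supports the square of the sum is the sum of the
    squares, so the same geometric series bounds the L^2 norm. *)
Lemma RInt_train eta h N b : 0 < eta -> (forall n, 0 <= h n) -> 0 <= b ->
  RInt (train eta h N) 0 b <= eta * (1 - (/ 2) ^ N) /\
  RInt (fun t => train eta h N t * train eta h N t) 0 b <= eta * (1 - (/ 2) ^ N).
Proof.
  intros He Hh Hb; induction N as [|N [IH1 IH2]].
  - rewrite pow_O, !RInt_eq0 by (intros; simpl; ring); lra.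
  - destruct (width_bounds eta h N He (Hh N)) as [[Hd1 Hd2] Hd3].
    assert (Hs : width eta h N + 1 <= INR N + 2) by (assert (H := pos_INR N); lra).
    assert (Hhn := Hh N).
    set (a := spike (h N) (INR N + 2) (width eta h N)).
    assert (Sa : smooth a) by apply smooth_spike.
    assert (St := smooth_train eta h N).
    assert (Hp : 0 <= h N * width eta h N) by (apply Rmult_le_pos; lra).
    assert (Hpp : 0 <= h N * h N * width eta h N) by (apply Rmult_le_pos; [nra|lra]).
    simpl in Hd3; split.
    + assert (H : RInt a 0 b <= 8 * h N * width eta h N).
      { apply RInt_le_kernel with (INR N + 2); auto.
        intros t Ht; now apply spike_le_kernel. }
      change (train eta h (S N)) with (fun t => plus (train eta h N t) (a t)).
      rewrite (@RInt_plus R_CompleteNormedModule) by now apply smooth_ex_RInt.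
      unfold plus; simpl; lra.
    + assert (H : RInt (fun t => a t * a t) 0 b <= 8 * (2 * h N * h N) * width eta h N).
      { apply RInt_le_kernel with (INR N + 2); auto; [nra|now apply smooth_mult|].
        intros t Ht; now apply spike_sqr_le_kernel. }
      rewrite (RInt_ext _ (fun t => plus (train eta h N t * train eta h N t) (a t * a t))).
      * rewrite (@RInt_plus R_CompleteNormedModule) by now apply smooth_ex_RInt, smooth_mult.
        unfold plus; simpl; lra.
      * intros t _; unfold plus; simpl; fold a.
        assert (E := train_orth eta h N t He Hh); fold a in E.
        transitivity (train eta h N t * train eta h N t + a t * a t
          + 2 * (train eta h N t * a t)); [ring|rewrite E; ring].
Qed.

Lemma nat_above x : exists N, x <= INR N.
Proof.
  destruct (nfloor_ex (Rmax x 0)) as [n Hn]; [apply Rmax_r|].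
  exists (S n); rewrite S_INR; assert (H := Rmax_l x 0); lra.
Qed.

Lemma spike_train_exists (h : nat -> R) (eta : R) :
  (forall n, 0 <= h n) -> 0 < eta ->
  exists phi : R -> R,
    smooth phi /\ (forall t, phi (- t) = phi t) /\ (forall t, 0 <= phi t) /\
    (forall t, t * t <= 1 -> phi t = 0) /\
    (forall n, h n <= phi (sqrt (INR n + 2))) /\
    (forall b, 0 <= b -> RInt phi 0 b <= eta) /\
    (forall b, 0 <= b -> RInt (fun t => phi t * phi t) 0 b <= eta).
Proof.
  intros Hh He.
  (* The number of spikes varies with t, but [up (t * t)] exceeds t^2, so by stability any longer
     train gives the same value. *)
  set (phi := fun t => train eta h (Z.to_nat (up (t * t))) t).
  assert (Hphi : forall N t, t * t <= INR N -> phi t = train eta h N t).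
  { intros N t HN; unfold phi.
    set (M := Z.to_nat (up (t * t))).
    assert (HM : t * t <= INR M).
    { unfold M; destruct (archimed (t * t)) as [H _].
      rewrite INR_IZR_INZ, Z2Nat.id; [lra|].
      apply le_IZR; nra. }
    rewrite <- (train_stable eta h M N t), <- (train_stable eta h N M t) by assumption.
    now rewrite Nat.add_comm. }
  assert (HB : forall N, 0 <= eta * (/ 2) ^ N).
  { intros N; apply Rmult_le_pos; [lra|apply pow_le; lra]. }
  exists phi; repeat split.
  - intros n; apply ndiff_loc; intros x.
    destruct (nat_above ((Rabs x + 1) * (Rabs x + 1))) as [N HN].
    exists (train eta h N); split; [apply smooth_train|].
    exists (mkposreal 1 Rlt_0_1); intros y Hy; symmetry; apply Hphi.
    apply Rle_trans with (2 := HN).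
    change (Rabs (y - x) < 1) in Hy.
    assert (Hyx : Rabs y <= Rabs x + 1).
    { replace y with (x + (y - x)) by ring.
      apply Rle_trans with (1 := Rabs_triang _ _); lra. }
    replace (y * y) with (Rabs y * Rabs y)
      by (rewrite <- Rabs_mult; apply Rabs_pos_eq; nra).
    assert (H := Rabs_pos y); apply Rmult_le_compat; lra.
  - intros t; unfold phi; rewrite Rmult_opp_opp.
    induction (Z.to_nat (up (t * t))) as [|n IH]; [reflexivity|]; simpl.
    rewrite IH; unfold spike; now rewrite Rmult_opp_opp.
  - intros t; now apply train_ge0.
  - intros t Ht; unfold phi; apply train_out; auto.
  - intros n; assert (Hn := pos_INR n).
    assert (E : sqrt (INR n + 2) * sqrt (INR n + 2) = INR n + 2) by (apply sqrt_sqrt; lra).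
    (* The train of length n + 3 is exact at t^2 = n + 2. Spike n is there at its centre, with full
       height; all other terms are only needed to be nonnegative. *)
    rewrite (Hphi (S (S (S n)))) by (rewrite E, !S_INR; lra).
    change (S (S (S n))) with (2 + S n)%nat.
    simpl.
    assert (H := train_ge0 eta h n (sqrt (INR n + 2)) Hh).
    assert (H1 := spike_ge0 (h (S n)) (INR (S n) + 2) (width eta h (S n)) (sqrt (INR n + 2)) (Hh _)).
    assert (H2 := spike_ge0 (h (S (S n))) (INR (S (S n)) + 2) (width eta h (S (S n))) (sqrt (INR n + 2)) (Hh _)).
    assert (Hs : spike (h n) (INR n + 2) (width eta h n) (sqrt (INR n + 2)) = h n).
    { unfold spike; rewrite E, Rminus_diag; unfold Rdiv; rewrite Rmult_0_l, bump_0; ring. }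
    simpl in *; lra.
  - intros b Hb; destruct (nat_above (b * b)) as [N HN].
    rewrite (RInt_ext _ (train eta h N)).
    + destruct (RInt_train eta h N b He Hh Hb) as [H _].
      assert (H' := HB N); lra.
    + intros x; rewrite Rmin_left, Rmax_right by exact Hb; intros Hx.
      apply Hphi; nra.
  - intros b Hb; destruct (nat_above (b * b)) as [N HN].
    rewrite (RInt_ext _ (fun t => train eta h N t * train eta h N t)).
    + destruct (RInt_train eta h N b He Hh Hb) as [_ H].
      assert (H' := HB N); lra.
    + intros x; rewrite Rmin_left, Rmax_right by exact Hb; intros Hx.
      rewrite (Hphi N); [reflexivity|nra].
Qed.

(** * Improper integrals *)

(** Replaces the quantification over integrability proofs by the total function [RInt], restricted
    to b >= 0. *)
Lemma improper_int0_RInt f l : improper_int0 f l <->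
  (forall b, 0 <= b -> ex_RInt f 0 b) /\
  (forall eps, 0 < eps ->
    exists B, forall b, 0 <= b -> B <= b -> Rabs (RInt f 0 b - l) < eps).
Proof.
  split; intros [H1 H2].
  - assert (Hi : forall b, 0 <= b -> ex_RInt f 0 b).
    { intros b Hb; destruct (H1 b Hb) as [pr _]; now apply ex_RInt_Reals_1. }
    split; [exact Hi|].
    intros eps He; destruct (H2 eps He) as [B HB]; exists B; intros b Hb HBb.
    assert (pr := ex_RInt_Reals_0 f 0 b (Hi b Hb)).
    rewrite (RInt_Reals f 0 b pr); now apply HB.
  - split.
    + intros b Hb; exists (ex_RInt_Reals_0 f 0 b (H1 b Hb)); exact I.
    + intros eps He; destruct (H2 eps He) as [B HB].
      exists (Rmax B 0); intros b pr Hb.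
      assert (HL := Rmax_l B 0); assert (HR := Rmax_r B 0).
      rewrite <- RInt_Reals; apply HB; lra.
Qed.

Lemma RInt_ext0 (f g : R -> R) b : 0 <= b -> (forall t, 0 < t -> f t = g t) ->
  RInt f 0 b = RInt g 0 b.
Proof.
  intros Hb H; apply RInt_ext; intros x.
  rewrite Rmin_left by exact Hb; intros Hx; now apply H.
Qed.

Lemma improper_int0_ext f g l : (forall t, 0 < t -> f t = g t) ->
  improper_int0 f l -> improper_int0 g l.
Proof.
  intros E [H1 H2]%improper_int0_RInt; apply improper_int0_RInt; split.
  - intros b Hb; apply ex_RInt_ext with f; [|now apply H1].
    intros x; rewrite Rmin_left by exact Hb; intros Hx; now apply E.
  - intros eps He; destruct (H2 eps He) as [B HB]; exists B; intros b Hb HBb.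
    rewrite <- (RInt_ext0 f g b Hb E); now apply HB.
Qed.

Lemma improper_int0_opp f l : improper_int0 f l -> improper_int0 (fun t => - f t) (- l).
Proof.
  intros [H1 H2]%improper_int0_RInt; apply improper_int0_RInt; split.
  - intros b Hb; apply (@ex_RInt_opp R_NormedModule f); now apply H1.
  - intros eps He; destruct (H2 eps He) as [B HB]; exists B; intros b Hb HBb.
    assert (E : RInt (fun t => - f t) 0 b = - RInt f 0 b)
      by (apply (@RInt_opp R_CompleteNormedModule f); now apply H1).
    rewrite E, <- Rabs_Ropp.
    replace (- (- RInt f 0 b - - l)) with (RInt f 0 b - l) by ring.
    now apply HB.
Qed.

Lemma RInt_incr (f : R -> R) a b : (forall t, 0 < t -> 0 <= f t) ->
  (forall b, 0 <= b -> ex_RInt f 0 b) -> 0 <= a <= b -> RInt f 0 a <= RInt f 0 b.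
Proof.
  intros Hf Hi Hab.
  assert (Ha : ex_RInt f 0 a) by (apply Hi; lra).
  assert (Hab' : ex_RInt f a b).
  { apply (@ex_RInt_Chasles_2 R_CompleteNormedModule) with 0; [lra|apply Hi; lra]. }
  rewrite <- (RInt_Chasles f 0 a b Ha Hab'); unfold plus; simpl.
  assert (0 <= RInt f a b); [|lra].
  apply RInt_ge_0; [lra|exact Hab'|intros x Hx; apply Hf; lra].
Qed.

Lemma RInt_le_improper f l b : (forall t, 0 < t -> 0 <= f t) ->
  improper_int0 f l -> 0 <= b -> RInt f 0 b <= l.
Proof.
  intros Hf [H1 H2]%improper_int0_RInt Hb.
  apply Rnot_lt_le; intros Hl.
  destruct (H2 (RInt f 0 b - l)) as [B HB]; [lra|].
  assert (HL := Rmax_l B b); assert (HR := Rmax_r B b).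
  specialize (HB (Rmax B b) ltac:(lra) HL).
  apply Rabs_def2 in HB.
  assert (H := RInt_incr f b (Rmax B b) Hf H1 ltac:(lra)); lra.
Qed.

(** The partial integrals increase with b, so their supremum is their limit. *)
Lemma improper_int0_bounded (f : R -> R) C : (forall t, 0 < t -> 0 <= f t) ->
  (forall b, 0 <= b -> ex_RInt f 0 b) -> (forall b, 0 <= b -> RInt f 0 b <= C) ->
  exists l, improper_int0 f l /\ l <= C.
Proof.
  intros Hf Hi HC.
  destruct (completeness (fun y => exists b, 0 <= b /\ y = RInt f 0 b)) as [l [Hu Hl]].
  - exists C; intros y [b [Hb ->]]; now apply HC.
  - exists (RInt f 0 0), 0; split; [lra|reflexivity].
  - exists l; split; [|apply Hl; intros y [b [Hb ->]]; now apply HC].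
    apply improper_int0_RInt; split; [exact Hi|].
    intros eps He.
    destruct (Classical_Prop.classic (exists B, 0 <= B /\ l - eps < RInt f 0 B))
      as [[B [HB0 HB]]|N].
    + exists B; intros b Hb HBb.
      assert (H := RInt_incr f B b Hf Hi (conj HB0 HBb)).
      assert (H' : RInt f 0 b <= l) by (apply Hu; now exists b).
      apply Rabs_def1; lra.
    + exfalso; assert (H : l <= l - eps); [|lra].
      apply Hl; intros y [b [Hb ->]].
      apply Rnot_lt_le; intros Hy; apply N; now exists b.
Qed.

Lemma improper_int0_dist f g l l' C : improper_int0 f l -> improper_int0 g l' ->
  (forall b, 0 <= b -> Rabs (RInt f 0 b - RInt g 0 b) <= C) -> Rabs (l - l') <= C.
Proof.
  intros [_ Hf]%improper_int0_RInt [_ Hg]%improper_int0_RInt HC.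
  apply Rnot_lt_le; intros Hlt.
  set (e := (Rabs (l - l') - C) / 2); assert (He : 0 < e) by (unfold e; lra).
  destruct (Hf e He) as [B HB], (Hg e He) as [B' HB'].
  set (b := Rmax 0 (Rmax B B')).
  assert (b0 : 0 <= b) by apply Rmax_l.
  assert (b1 : Rmax B B' <= b) by apply Rmax_r.
  assert (b2 := Rmax_l B B'); assert (b3 := Rmax_r B B').
  specialize (HB b b0 ltac:(lra)); specialize (HB' b b0 ltac:(lra)); specialize (HC b b0).
  rewrite Rabs_minus_sym in HB.
  assert (T : Rabs (l - l') <= Rabs (l - RInt f 0 b) + Rabs (RInt f 0 b - RInt g 0 b)
                + Rabs (RInt g 0 b - l')).
  { replace (l - l') with ((l - RInt f 0 b) + (RInt f 0 b - RInt g 0 b)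
                + (RInt g 0 b - l')) by ring.
    apply Rle_trans with (1 := Rabs_triang _ _); apply Rplus_le_compat_r, Rabs_triang. }
  unfold e in *; lra.
Qed.

Definition pospart (x : R) : R := Rmax x 0.

Lemma pospart_abs x : pospart x = / 2 * (x + Rabs x).
Proof.
  unfold pospart, Rmax, Rabs; destruct (Rle_dec x 0), (Rcase_abs x); lra.
Qed.

Lemma ex_RInt_pospart h a b : smooth h -> ex_RInt (fun t => pospart (h t)) a b.
Proof.
  intros Hh; apply ex_RInt_ext with (fun t => scal (/ 2) (plus (h t) (norm (h t)))).
  - intros x _; symmetry; apply pospart_abs.
  - apply (@ex_RInt_scal R_NormedModule), (@ex_RInt_plus R_NormedModule);
      [now apply smooth_ex_RInt|].
    apply ex_RInt_norm; now apply smooth_ex_RInt.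
Qed.

Lemma pospart_lip x y : Rabs (pospart x - pospart y) <= Rabs (x - y).
Proof.
  unfold pospart, Rmax, Rabs.
  destruct (Rle_dec x 0), (Rle_dec y 0); repeat destruct (Rcase_abs _); lra.
Qed.

(** Since the positive part is 1-Lipschitz, all partial integrals for [h] and [k] differ by at most
    E. Those for [k] are then bounded by a + E, which yields convergence, and the distance passes to
    the limit. *)
Lemma improper_pospart_perturb h k q a E : smooth h -> smooth k ->
  improper_int0 (fun t => pospart (h t)) a ->
  (forall t, 0 < t -> Rabs (h t - k t) <= q t) ->
  (forall b, 0 <= b -> ex_RInt q 0 b) -> (forall b, 0 <= b -> RInt q 0 b <= E) ->
  exists a', improper_int0 (fun t => pospart (k t)) a' /\ Rabs (a - a') <= E.
Proof.
  intros Sh Sk Ha Hq Iq HE.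
  set (H := fun t => pospart (h t)); set (K := fun t => pospart (k t)).
  assert (Hd : forall b, 0 <= b -> Rabs (RInt H 0 b - RInt K 0 b) <= E).
  { intros b Hb.
    assert (IH : ex_RInt H 0 b) by now apply ex_RInt_pospart.
    assert (IK : ex_RInt K 0 b) by now apply ex_RInt_pospart.
    assert (I1 := @ex_RInt_minus R_NormedModule H K 0 b IH IK).
    replace (RInt H 0 b - RInt K 0 b) with (RInt (fun t => minus (H t) (K t)) 0 b)
      by (apply (@RInt_minus R_CompleteNormedModule); assumption).
    apply Rle_trans with (2 := HE b Hb).
    apply Rle_trans with (1 := abs_RInt_le _ _ _ Hb I1).
    apply RInt_le; [exact Hb|exact (ex_RInt_norm _ _ _ I1)|now apply Iq|].
    intros t Ht; apply Rle_trans with (2 := Hq t (proj1 Ht)).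
    apply pospart_lip. }
  assert (H0 : forall x, 0 <= pospart x) by (intros; apply Rmax_r).
  destruct (improper_int0_bounded K (a + E)) as [a' [Ha' _]].
  - intros t _; apply H0.
  - intros b _; now apply ex_RInt_pospart.
  - intros b Hb; assert (H1 := Hd b Hb).
    assert (H2 := RInt_le_improper H a b (fun t _ => H0 _) Ha Hb).
    apply Rabs_le_between in H1; lra.
  - exists a'; split; [exact Ha'|].
    now apply improper_int0_dist with H K.
Qed.

(** * Total curvature in terms of the profile *)

Lemma radial_curv_pos D t : 0 < t -> radial_curv D t = - D 2%nat t / D 0%nat t.
Proof. intros Ht; unfold radial_curv; destruct (Req_EM_T t 0); [lra|reflexivity]. Qed.

Lemma curv_pospart x y : 0 < y -> Rmax (- x / y) 0 * y = pospart (- x).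
Proof.
  intros Hy; unfold pospart.
  rewrite Rmult_comm, <- RmaxRmult by lra.
  f_equal; [field|ring]; lra.
Qed.

Lemma curv_negpart x y : 0 < y -> Rmin (- x / y) 0 * y = - pospart x.
Proof.
  intros Hy.
  replace (Rmin (- x / y) 0) with (- Rmax (- (- x) / y) 0).
  - rewrite Ropp_mult_distr_l_reverse, curv_pospart, Ropp_involutive by exact Hy; reflexivity.
  - rewrite <- (Ropp_involutive (Rmin _ _)), Ropp_Rmin, Ropp_0.
    do 2 f_equal; field; lra.
Qed.

(** As m > 0, the factor m of dA cancels the denominator of the curvature: G_+ m is the positive
    part of -m'' and G_- m is minus the positive part of m''. *)
Lemma total_curvature_pospart D c : is_model D -> (total_curvature D c <->
  exists a b, improper_int0 (fun t => pospart (- D 2%nat t)) a /\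
    improper_int0 (fun t => pospart (D 2%nat t)) b /\ c = 2 * PI * (a - b)).
Proof.
  intros (_ & _ & HD & _).
  assert (E1 : forall t, 0 < t ->
    Rmax (radial_curv D t) 0 * D 0%nat t = pospart (- D 2%nat t)).
  { intros t Ht; rewrite radial_curv_pos by exact Ht; now apply curv_pospart, HD. }
  assert (E2 : forall t, 0 < t ->
    Rmin (radial_curv D t) 0 * D 0%nat t = - pospart (D 2%nat t)).
  { intros t Ht; rewrite radial_curv_pos by exact Ht; now apply curv_negpart, HD. }
  split.
  - intros (a & b & Ha & Hb & Hc); exists a, (- b); split; [|split].
    + now apply improper_int0_ext with (1 := E1).
    + apply improper_int0_opp in Hb.
      apply improper_int0_ext with (2 := Hb); intros t Ht; rewrite E2 by exact Ht; ring.
    + rewrite Hc; ring.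
  - intros (a & b & Ha & Hb & Hc); exists a, (- b); split; [|split].
    + apply improper_int0_ext with (2 := Ha); intros t Ht; now rewrite E1.
    + apply improper_int0_opp in Hb.
      apply improper_int0_ext with (2 := Hb); intros t Ht; now rewrite E2.
    + rewrite Hc; ring.
Qed.

Lemma pospart_minus x : pospart x - pospart (- x) = x.
Proof. rewrite !pospart_abs, Rabs_Ropp; field. Qed.

(** f' is 1 plus the integral of f'', so it tends to 1 + b - a = 1 - c / 2 pi > 0. A positive slope
    from some T on, together with compactness on [1, T], gives the linear bound. *)
Lemma model_linear_growth D c : is_model D -> total_curvature D c -> c < 2 * PI ->
  exists c1, 0 < c1 /\ forall t, 1 <= t -> c1 * t <= D 0%nat t.
Proof.
  intros HM HT Hc.
  apply total_curvature_pospart in HT; [|exact HM].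
  destruct HT as (a & b & Ha & Hb & Hcab), HM as (HD & _ & Hpos & H1).
  assert (S2 := deriv_tower_smooth D 2 HD).
  assert (SN : smooth (fun t => - D 2%nat t)).
  { apply smooth_ext with (fun t => 0 - D 2%nat t); [intros; ring|].
    apply smooth_minus; [apply smooth_const|exact S2]. }
  assert (Hab : a - b < 1).
  { assert (HP := PI_RGT_0); apply Rmult_lt_reg_l with (2 * PI); lra. }
  (* A third of the limit slope: the two integrals each lose at most d, leaving f' >= 3 d - 2 d. *)
  set (d := (1 - (a - b)) / 3); assert (Hd : 0 < d) by (unfold d; lra).
  assert (FTC : forall t, D 1%nat t = 1 + (RInt (fun t => pospart (D 2%nat t)) 0 t
     - RInt (fun t => pospart (- D 2%nat t)) 0 t)).
  { intros t.
    assert (E := is_RInt_unique _ _ _ _ (is_RInt_minus _ _ _ _ _ _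
       (RInt_correct _ _ _ (ex_RInt_pospart _ 0 t S2))
       (RInt_correct _ _ _ (ex_RInt_pospart _ 0 t SN)))).
    unfold minus, plus, opp in E; simpl in E; unfold Rminus.
    rewrite <- E, (RInt_ext _ (D 2%nat)).
    - assert (I2 : is_RInt (D 2%nat) 0 t (minus (D 1%nat t) (D 1%nat 0))).
      { apply (@is_RInt_derive R_CompleteNormedModule (D 1%nat)).
        - intros x _; apply is_derive_Reals, HD.
        - intros x _; now apply smooth_continuous. }
      rewrite (is_RInt_unique _ _ _ _ I2), H1; unfold minus, plus, opp; simpl; ring.
    - intros x _; apply pospart_minus. }
  apply improper_int0_RInt in Ha, Hb; destruct Ha as [_ Ha], Hb as [_ Hb].
  destruct (Ha d Hd) as [T1 HT1], (Hb d Hd) as [T2 HT2].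
  set (T := Rmax 1 (Rmax T1 T2)).
  assert (T0 : 1 <= T) by apply Rmax_l.
  assert (TT : Rmax T1 T2 <= T) by apply Rmax_r.
  assert (TL := Rmax_l T1 T2); assert (TR := Rmax_r T1 T2).
  assert (Hder : forall t, T <= t -> d <= D 1%nat t).
  { intros t Ht; rewrite FTC.
    specialize (HT1 t ltac:(lra) ltac:(lra)); specialize (HT2 t ltac:(lra) ltac:(lra)).
    apply Rabs_def2 in HT1, HT2; unfold d in *; lra. }
  destruct (continuity_ab_min (fun t => D 0%nat t / t) 1 T T0) as [x0 [Hmin Hx0]].
  { intros t Ht; apply continuity_pt_div.
    - apply derivable_continuous_pt; exists (D 1%nat t); apply HD.
    - apply derivable_continuous_pt, derivable_pt_id.
    - lra. }
  set (c0 := D 0%nat x0 / x0).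
  assert (Hc0 : 0 < c0) by (apply Rdiv_lt_0_compat; [apply Hpos|]; lra).
  exists (Rmin c0 d); split; [now apply Rmin_pos|].
  assert (ML := Rmin_l c0 d); assert (MR := Rmin_r c0 d).
  assert (Hle : forall t, 1 <= t <= T -> Rmin c0 d * t <= D 0%nat t).
  { intros t Ht; specialize (Hmin t Ht); simpl in Hmin; fold c0 in Hmin.
    replace (D 0%nat t) with (D 0%nat t / t * t) by (field; lra).
    apply Rmult_le_compat_r; lra. }
  intros t Ht; destruct (Rle_or_lt t T) as [HtT|HtT]; [now apply Hle|].
  destruct (MVT_gen (D 0%nat) T t (D 1%nat)) as [x [Hx Heq]].
  - intros x _; apply is_derive_Reals, HD.
  - intros x _; apply derivable_continuous_pt; exists (D 1%nat x); apply HD.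
  - rewrite Rmin_left, Rmax_right in Hx by lra.
    assert (H := Hder x (proj1 Hx)); assert (HT' := Hle T (conj T0 (Rle_refl T))).
    assert (d * (t - T) <= D 1%nat x * (t - T)) by (apply Rmult_le_compat_r; lra).
    assert (Rmin c0 d * (t - T) <= d * (t - T)) by (apply Rmult_le_compat_r; lra).
    lra.
Qed.

(** * The perturbed profile *)

(* The flat bump only removes the zero of f^2 at the origin, so that dividing by g is harmless. *)
Lemma regularized_square D : is_model D -> exists g : R -> R,
  smooth g /\ (forall t, g (- t) = g t) /\ (forall t, 0 < g t) /\
  (forall t, 1 <= t * t -> g t = D 0%nat t * D 0%nat t).
Proof.
  intros (HD & Hodd & Hpos & _).
  assert (S0 := deriv_tower_smooth D 0 HD).
  exists (fun t => D 0%nat t * D 0%nat t + flat 0 (1 - t * t)).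
  split; [|split; [|split]].
  - apply smooth_plus; [now apply smooth_mult|].
    apply (smooth_comp (flat 0)); [apply smooth_flat|].
    apply smooth_minus; [apply smooth_const|apply smooth_mult; apply smooth_id].
  - intros t; rewrite Hodd, !Rmult_opp_opp; reflexivity.
  - intros t; destruct (Rlt_or_le (t * t) 1) as [Ht|Ht].
    + assert (H := flat_bound 0 (1 - t * t) ltac:(lra)); nra.
    + rewrite flat_neg, Rplus_0_r by lra.
      destruct (Rtotal_order t 0) as [H|[H|H]]; [|subst; lra|].
      * assert (H' := Hpos (- t) ltac:(lra)); rewrite Hodd in H'; nra.
      * assert (H' := Hpos t H); nra.
  - intros t Ht; rewrite flat_neg by lra; ring.
Qed.

Lemma RInt_reflect F t : smooth F -> RInt F 0 (- t) = - RInt (fun y => F (- y)) 0 t.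
Proof.
  intros HF.
  assert (HG : smooth (fun y => F (- y))).
  { apply (smooth_comp F); [exact HF|].
    apply smooth_ext with (fun y => 0 - y); [intros; ring|].
    apply smooth_minus; [apply smooth_const|apply smooth_id]. }
  rewrite <- (@RInt_opp R_CompleteNormedModule) by now apply smooth_ex_RInt.
  assert (E : RInt F (- 0) (- t) = RInt (fun y => - F (- y)) 0 t).
  { symmetry; apply is_RInt_unique.
    apply (@is_RInt_comp_opp R_NormedModule F).
    apply (@RInt_correct R_CompleteNormedModule); now apply smooth_ex_RInt. }
  rewrite Ropp_0 in E; exact E.
Qed.

Lemma is_RInt_inv_1_sqr t : is_RInt (fun x => / (1 + x * x)) 0 t (atan t).
Proof.
  replace (atan t) with (minus (atan t) (atan 0))
    by (rewrite atan_0; unfold minus, plus, opp; simpl; ring).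
  apply (@is_RInt_derive R_CompleteNormedModule atan).
  - intros x _; apply is_derive_atan.
  - intros x _; apply (@ex_derive_continuous R_AbsRing R_NormedModule).
    assert (H := one_plus_sqr_pos x); auto_derive; lra.
Qed.

(* Solves (f^2 u')' = phi with u = 1 near 0; then (f u)'' = f'' u + phi / f. *)
Lemma conformal_factor D g phi c1 eta : is_model D ->
  smooth g -> (forall t, g (- t) = g t) -> (forall t, 0 < g t) ->
  (forall t, 1 <= t * t -> g t = D 0%nat t * D 0%nat t) ->
  smooth phi -> (forall t, phi (- t) = phi t) -> (forall t, 0 <= phi t) ->
  (forall t, t * t <= 1 -> phi t = 0) ->
  0 < c1 -> (forall t, 1 <= t -> c1 * t <= D 0%nat t) ->
  0 < eta -> (forall b, 0 <= b -> RInt phi 0 b <= eta) ->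
  exists u : R -> R,
    smooth u /\ (forall t, u (- t) = u t) /\ (forall t, t * t <= 1 -> u t = 1) /\
    (forall t, 0 <= t -> 1 <= u t <= 1 + 4 * eta / (c1 * c1)) /\
    (forall t, D 0%nat t * Derive_n (fun x => D 0%nat x * u x) 2 t
       = D 0%nat t * (D 2%nat t * u t) + phi t).
Proof.
  intros (HD & Hodd & Hpos & _) Sg geven gpos gsq Sphi peven p0 pout Hc1 Hlin Heta Hint.
  assert (S0 := deriv_tower_smooth D 0 HD).
  set (w := RInt phi 0).
  assert (Sw : smooth w) by now apply smooth_RInt.
  assert (wodd : forall t, w (- t) = - w t).
  { intros t; unfold w; rewrite RInt_reflect by exact Sphi; f_equal.
    apply RInt_ext; intros; apply peven. }
  assert (inner : forall t x, t * t <= 1 -> Rmin 0 t < x < Rmax 0 t -> x * x <= 1).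
  { intros t x Ht Hx; unfold Rmin, Rmax in Hx; destruct (Rle_dec 0 t); nra. }
  assert (wout : forall t, t * t <= 1 -> w t = 0).
  { intros t Ht; apply RInt_eq0; intros x Hx; apply pout; now apply inner with t. }
  assert (wpos : forall t, 0 <= t -> 0 <= w t).
  { intros t Ht; apply RInt_ge_0; [exact Ht|now apply smooth_ex_RInt|auto]. }
  (* [v] is the future u' = w / f^2. Replacing f^2 by [g] changes nothing, since w vanishes wherever
     the two may differ, and it makes [v] smooth across the origin. *)
  set (v := fun t => w t * / g t).
  assert (gne : forall t, g t <> 0) by (intros t; apply Rgt_not_eq, gpos).
  assert (Sv : smooth v) by (apply smooth_mult; [exact Sw|now apply smooth_inv]).
  assert (vodd : forall t, v (- t) = - v t).
  { intros t; unfold v; rewrite wodd, geven; ring. }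
  assert (vout : forall t, t * t <= 1 -> v t = 0).
  { intros t Ht; unfold v; rewrite wout by exact Ht; ring. }
  assert (vpos : forall t, 0 <= t -> 0 <= v t).
  { intros t Ht; apply Rmult_le_pos; [now apply wpos|].
    apply Rlt_le, Rinv_0_lt_compat, gpos. }
  assert (vw : forall t, D 0%nat t * D 0%nat t * v t = w t).
  { intros t; destruct (Rle_or_lt (t * t) 1) as [Ht|Ht].
    - rewrite vout, wout by exact Ht; ring.
    - unfold v; rewrite <- gsq by lra; field; apply gne. }
  exists (fun t => 1 + RInt v 0 t); split; [|split; [|split; [|split]]].
  - apply smooth_plus; [apply smooth_const|now apply smooth_RInt].
  - intros t; rewrite RInt_reflect by exact Sv; f_equal.
    rewrite <- (@RInt_opp R_CompleteNormedModule).
    + apply RInt_ext; intros x _; unfold opp; simpl; rewrite vodd; ring.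
    + apply ex_RInt_ext with (fun y => opp (v y)).
      * intros x _; rewrite vodd; reflexivity.
      * apply (@ex_RInt_opp R_NormedModule); now apply smooth_ex_RInt.
  - intros t Ht; rewrite RInt_eq0; [ring|].
    intros x Hx; apply vout; now apply inner with t.
  - intros t Ht.
    assert (Iv : ex_RInt v 0 t) by now apply smooth_ex_RInt.
    assert (H0 : 0 <= RInt v 0 t).
    { apply RInt_ge_0; [exact Ht|exact Iv|intros x Hx; apply vpos; lra]. }
    (* For x > 1, v <= eta / (c1 x)^2 <= k / (1 + x^2), the factor 2 coming from 1 + x^2 <= 2 x^2.
       The bound atan <= 2 then produces 4 eta / c1^2. *)
    set (k := 2 * eta / (c1 * c1)).
    assert (Hcc : 0 < c1 * c1) by now apply Rmult_lt_0_compat.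
    assert (Hk : 0 < k) by (apply Rdiv_lt_0_compat; lra).
    assert (IA := is_RInt_scal _ _ _ k _ (is_RInt_inv_1_sqr t)).
    assert (H1 : RInt v 0 t <= k * atan t).
    { replace (k * atan t) with (RInt (fun x => scal k (/ (1 + x * x))) 0 t)
        by exact (is_RInt_unique _ _ _ _ IA).
      apply RInt_le; [exact Ht|exact Iv|eexists; exact IA|].
      intros x Hx; unfold scal; simpl; unfold mult; simpl.
      assert (HX := one_plus_sqr_pos x).
      assert (HXi := Rinv_0_lt_compat _ HX).
      destruct (Rle_or_lt (x * x) 1) as [Hx1|Hx1].
      - rewrite vout by exact Hx1; apply Rmult_le_pos; lra.
      - assert (Hf : c1 * x <= D 0%nat x) by (apply Hlin; nra).
        assert (Hcx : 0 < c1 * x) by (apply Rmult_lt_0_compat; lra).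
        assert (Hg : c1 * x * (c1 * x) <= g x).
        { rewrite gsq by lra; apply Rmult_le_compat; lra. }
        assert (Hcx2 : 0 < c1 * x * (c1 * x)) by now apply Rmult_lt_0_compat.
        unfold v; apply Rle_trans with (eta * / (c1 * x * (c1 * x))).
        + apply Rmult_le_compat; [apply wpos; lra| |apply Hint; lra|].
          * apply Rlt_le, Rinv_0_lt_compat, gpos.
          * now apply Rinv_le_contravar.
        + apply Rmult_le_reg_r with (c1 * x * (c1 * x) * (1 + x * x));
            [now apply Rmult_lt_0_compat|].
          replace (eta * / (c1 * x * (c1 * x)) * (c1 * x * (c1 * x) * (1 + x * x)))
            with (eta * (1 + x * x)) by (field; lra).
          replace (k * / (1 + x * x) * (c1 * x * (c1 * x) * (1 + x * x)))
            with (eta * (2 * (x * x))) by (unfold k; field; lra).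
          apply Rmult_le_compat_l; lra. }
    assert (HB := atan_bound t); assert (HP := PI_4).
    replace (4 * eta / (c1 * c1)) with (k * 2) by (unfold k; field; lra).
    assert (k * atan t <= k * 2) by (apply Rmult_le_compat_l; lra).
    lra.
  - intros t.
    set (u := fun t => 1 + RInt v 0 t).
    assert (Du : forall x, is_derive u x (v x)).
    { intros x; replace (v x) with (0 + v x) by ring.
      apply (@is_derive_plus R_AbsRing R_NormedModule);
        [apply (@is_derive_const R_AbsRing R_NormedModule)|now apply smooth_is_derive_RInt]. }
    assert (Dv : forall x, is_derive v x (Derive v x)) by (intros; now apply smooth_is_derive).
    assert (D0 : forall x, is_derive (D 0%nat) x (D 1%nat x)) by (intros; apply is_derive_Reals, HD).
    assert (D1 : forall x, is_derive (D 1%nat) x (D 2%nat x)) by (intros; apply is_derive_Reals, HD).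
    assert (prod : forall F G F' G' x, is_derive F x F' -> is_derive G x G' ->
      is_derive (fun x => F x * G x) x (F' * G x + F x * G')).
    { intros F G F' G' x HF HG; apply (is_derive_mult F G); auto.
      intros p q; apply Rmult_comm. }
    assert (E2 : Derive_n (fun x => D 0%nat x * u x) 2 t
      = D 2%nat t * u t + D 1%nat t * v t + (D 1%nat t * v t + D 0%nat t * Derive v t)).
    { simpl; rewrite (Derive_ext _ (fun x => D 1%nat x * u x + D 0%nat x * v x)).
      - apply is_derive_unique, (@is_derive_plus R_AbsRing R_NormedModule); now apply prod.
      - intros x; apply is_derive_unique; now apply prod. }
    (* Differentiating f^2 v = w gives phi = f (2 f' v + f v'), which is f times the excess of (f
       u)'' over f'' u. Keeping the factor f avoids division at t = 0. *)
    assert (E3 : phi t = (D 1%nat t * D 0%nat t + D 0%nat t * D 1%nat t) * v t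
      + D 0%nat t * D 0%nat t * Derive v t).
    { transitivity (Derive w t).
      - symmetry; apply is_derive_unique; now apply smooth_is_derive_RInt.
      - apply is_derive_unique.
        apply is_derive_ext with (fun x => D 0%nat x * D 0%nat x * v x); [exact vw|].
        apply (prod (fun x => D 0%nat x * D 0%nat x)); [now apply prod|apply Dv]. }
    change (D 0%nat t * Derive_n (fun x => D 0%nat x * u x) 2 t
      = D 0%nat t * (D 2%nat t * u t) + phi t).
    rewrite E2, E3; ring.
Qed.

(** * Choice of the constants and conclusion *)

Lemma small_parameter X Y Z : 0 < X -> 0 <= Y -> 0 < Z -> forall W, 0 < W ->
  exists eta, 0 < eta /\ eta <= X /\ eta * Y <= Z /\ eta <= W.
Proof.
  intros HX HY HZ W HW.
  assert (HQ : 0 < Z / (Y + 1)) by (apply Rdiv_lt_0_compat; lra).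
  exists (Rmin X (Rmin (Z / (Y + 1)) W)).
  assert (H1 := Rmin_l X (Rmin (Z / (Y + 1)) W)).
  assert (H2 := Rmin_r X (Rmin (Z / (Y + 1)) W)).
  assert (H3 := Rmin_l (Z / (Y + 1)) W); assert (H4 := Rmin_r (Z / (Y + 1)) W).
  assert (H0 : 0 < Rmin X (Rmin (Z / (Y + 1)) W)) by (repeat apply Rmin_pos; lra).
  repeat split; try lra.
  apply Rle_trans with (Z / (Y + 1) * (Y + 1)); [|right; field; lra].
  apply Rmult_le_compat; lra.
Qed.

Theorem theorem1p4 (Df : nat -> R -> R) (c : R) :
  is_model Df -> total_curvature Df c -> c < 2 * PI ->
  forall eps : R, 0 < eps ->
  exists (Dm : nat -> R -> R) (cm : R),
    is_model Dm /\
    total_curvature Dm cm /\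
    (forall t, 0 <= t -> radial_curv Dm t <= radial_curv Df t) /\
    (exists l, improper_int0 (fun t => (radial_curv Dm t - radial_curv Df t) ^ 2) l
               /\ sqrt l < eps) /\
    (forall M T : R, exists t, T < t /\ radial_curv Dm t < M) /\
    Rabs (c - cm) < eps.
Proof.
  intros HM HT Hc eps Heps.
  destruct (model_linear_growth Df c HM HT Hc) as (c1 & Hc1 & Hlin).
  destruct (regularized_square Df HM) as (g & Sg & geven & gpos & gsq).
  apply total_curvature_pospart in HT; [|exact HM].
  destruct HT as (a & b & Ha & Hb & Hcab).
  pose proof HM as (HD & Hodd & Hpos & H1).
  set (f := Df 0%nat) in *.
  assert (S0 : smooth f) by now apply deriv_tower_smooth.
  assert (S2 : smooth (Df 2%nat)) by now apply deriv_tower_smooth.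
  assert (Sopp : forall h, smooth h -> smooth (fun t => - h t)).
  { intros h Sh; apply smooth_ext with (fun t => 0 - h t); [intros; ring|].
    apply smooth_minus; [apply smooth_const|exact Sh]. }
  assert (pp0 : forall x, 0 <= pospart x) by (intros; apply Rmax_r).
  assert (Hcc : 0 < c1 * c1) by now apply Rmult_lt_0_compat.
  assert (Hint_a := fun t => RInt_le_improper _ a t (fun x _ => pp0 _) Ha).
  assert (Hint_b := fun t => RInt_le_improper _ b t (fun x _ => pp0 _) Hb).
  assert (Hab : 0 <= a + b).
  { assert (Ka := Hint_a 0 (Rle_refl 0)); assert (Kb := Hint_b 0 (Rle_refl 0)).
    rewrite RInt_point in Ka, Kb; unfold zero in Ka, Kb; simpl in Ka, Kb; lra. }
  (* eta Y will bound the L^1 distance of f'' and m'': a + b is the integral of |f''|, weighted by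
     sup (u - 1), and the last term bounds that of phi / f. *)
  set (Y := 4 * (a + b) / (c1 * c1) + / c1).
  assert (HY : 0 <= Y).
  { apply Rplus_le_le_0_compat; [|now apply Rlt_le, Rinv_0_lt_compat].
    apply Rle_div_r; [exact Hcc|lra]. }
  (* The bound c1^2 / 4 gives u <= 2; eps / 32 is the L^1 error allowed for each part of the
     curvature; the last bound makes eta / c1^4 <= eps^2 / 4 for the L^2 norm. *)
  destruct (small_parameter (c1 * c1 / 4) Y (eps / 32) ltac:(lra) HY ltac:(lra)
    (eps * eps / 4 * (c1 * c1 * (c1 * c1)))) as (eta & Heta & Heta1 & Heta2 & Heta3).
  { apply Rmult_lt_0_compat; [nra|now apply Rmult_lt_0_compat]. }
  set (kap := 4 * eta / (c1 * c1)).
  assert (Hkap : 0 <= kap <= 1).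
  { unfold kap; split; [apply Rle_div_r; lra|apply Rle_div_l; lra]. }
  (* The leading 2 is the a priori bound on u, so that phi / (f^2 u) >= |K| + n at the n-th
     centre. *)
  destruct (spike_train_exists (fun n => 2 * (f (sqrt (INR n + 2)) * f (sqrt (INR n + 2)))
      * (Rabs (radial_curv Df (sqrt (INR n + 2))) + INR n)) eta)
    as (phi & Sphi & peven & p0 & pout & pheight & pint & psqr).
  { intros n; apply Rmult_le_pos; [nra|].
    apply Rplus_le_le_0_compat; [apply Rabs_pos|apply pos_INR]. }
  { exact Heta. }
  destruct (conformal_factor Df g phi c1 eta) as (u & Su & ueven & uin & ubd & u2); auto.
  fold kap in ubd.
  set (m := fun x => f x * u x) in *.
  assert (Sm : smooth m) by now apply smooth_mult.
  assert (upos : forall t, 0 < u t).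
  { intros t; destruct (Rle_or_lt 0 t) as [Ht|Ht].
    - assert (H := ubd t Ht); lra.
    - rewrite <- ueven; assert (H := ubd (- t) ltac:(lra)); lra. }
  assert (fpos1 : forall t, 1 <= t -> c1 <= f t).
  { intros t Ht; assert (H := Hlin t Ht); fold f in H; nra. }
  assert (m2 : forall t, 0 < t -> Derive_n m 2 t = Df 2%nat t * u t + phi t / f t).
  { intros t Ht; assert (Hf := Hpos t Ht).
    apply Rmult_eq_reg_l with (f t); [|lra].
    unfold m, f in *; rewrite u2; field; lra. }
  (* u = 1 near 0, so all derivatives agree there, including the third one, through which the
     curvature at the origin is defined. *)
  assert (mloc : forall n, Derive_n m n 0 = Df n 0).
  { intros n; rewrite <- (deriv_tower_Derive_n Df n 0 HD).
    apply Derive_n_ext_loc; exists (mkposreal 1 Rlt_0_1); intros y Hy.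
    change (Rabs (y - 0) < 1) in Hy; rewrite Rminus_0_r in Hy.
    apply Rabs_def2 in Hy; unfold m; rewrite uin by nra; unfold f; ring. }
  assert (Mm : is_model (Derive_n m)).
  { split; [now apply smooth_deriv_tower|split; [|split]].
    - intros t; simpl; unfold m; rewrite ueven, Hodd; ring.
    - intros t Ht; simpl; apply Rmult_lt_0_compat; [now apply Hpos|apply upos].
    - now rewrite mloc. }
  assert (G0 : radial_curv (Derive_n m) 0 = radial_curv Df 0).
  { unfold radial_curv; destruct (Req_EM_T 0 0); [now rewrite mloc|lra]. }
  assert (GK : forall t, 0 < t -> radial_curv (Derive_n m) t
    = radial_curv Df t - phi t / (f t * f t * u t)).
  { intros t Ht; rewrite !radial_curv_pos, m2 by exact Ht.
    change (Derive_n m 0 t) with (f t * u t); fold f.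
    assert (Hf := Hpos t Ht); assert (Hu := upos t); field; lra. }
  assert (Hdiff : forall t, 0 < t -> Rabs (Df 2%nat t - Derive_n m 2 t)
    <= kap * (pospart (- Df 2%nat t) + pospart (Df 2%nat t)) + / c1 * phi t).
  { intros t Ht; rewrite m2 by exact Ht.
    replace (Df 2%nat t - (Df 2%nat t * u t + phi t / f t))
      with (- (Df 2%nat t * (u t - 1) + phi t / f t)) by ring.
    rewrite Rabs_Ropp; apply Rle_trans with (1 := Rabs_triang _ _).
    assert (Hu := ubd t (Rlt_le _ _ Ht)).
    apply Rplus_le_compat.
    - rewrite !pospart_abs, Rabs_Ropp, Rabs_mult, (Rabs_pos_eq (u t - 1)) by lra.
      replace (/ 2 * (- Df 2%nat t + Rabs (Df 2%nat t)) + / 2 * (Df 2%nat t + Rabs (Df 2%nat t)))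
        with (Rabs (Df 2%nat t)) by field.
      rewrite Rmult_comm; apply Rmult_le_compat_r; [apply Rabs_pos|lra].
    - destruct (Rle_or_lt t 1) as [Ht1|Ht1].
      + rewrite pout by nra; unfold Rdiv; rewrite Rmult_0_l, Rabs_R0; lra.
      + assert (Hf := fpos1 t ltac:(lra)); assert (Hp := p0 t).
        rewrite Rabs_pos_eq by (apply Rle_div_r; lra).
        unfold Rdiv; rewrite Rmult_comm; apply Rmult_le_compat_r; [exact Hp|].
        apply Rinv_le_contravar; lra. }
  set (q := fun t => kap * (pospart (- Df 2%nat t) + pospart (Df 2%nat t)) + / c1 * phi t) in Hdiff.
  assert (Iq : forall t, 0 <= t -> is_RInt q 0 t
    (kap * (RInt (fun t => pospart (- Df 2%nat t)) 0 t + RInt (fun t => pospart (Df 2%nat t)) 0 t)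
     + / c1 * RInt phi 0 t)).
  { intros t Ht.
    apply (@is_RInt_plus R_NormedModule); apply (@is_RInt_scal R_NormedModule).
    - apply (@is_RInt_plus R_NormedModule);
        apply (@RInt_correct R_CompleteNormedModule), ex_RInt_pospart; auto.
    - apply (@RInt_correct R_CompleteNormedModule); now apply smooth_ex_RInt. }
  assert (Eq : forall t, 0 <= t -> RInt q 0 t <= eps / 32).
  { intros t Ht; rewrite (is_RInt_unique _ _ _ _ (Iq t Ht)).
    apply Rle_trans with (2 := Heta2); unfold Y.
    replace (eta * (4 * (a + b) / (c1 * c1) + / c1)) with (kap * (a + b) + / c1 * eta)
      by (unfold kap; field; lra).
    assert (Hi := Rinv_0_lt_compat _ Hc1).
    specialize (Hint_a t Ht); specialize (Hint_b t Ht); specialize (pint t Ht).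
    apply Rplus_le_compat; apply Rmult_le_compat_l; lra. }
  assert (Sm2 : smooth (Derive_n m 2)) by now apply smooth_Derive_n.
  assert (eIq : forall t, 0 <= t -> ex_RInt q 0 t) by (intros t Ht; eexists; now apply Iq).
  destruct (improper_pospart_perturb (fun t => - Df 2%nat t) (fun t => - Derive_n m 2 t)
    q a (eps / 32)) as (a' & Ha' & Haa); auto.
  { intros t Ht; replace (- Df 2%nat t - - Derive_n m 2 t)
      with (- (Df 2%nat t - Derive_n m 2 t)) by ring; rewrite Rabs_Ropp; auto. }
  destruct (improper_pospart_perturb (Df 2%nat) (Derive_n m 2) q b (eps / 32))
    as (b' & Hb' & Hbb); auto.
  exists (Derive_n m), (2 * PI * (a' - b')).
  split; [exact Mm|]; split; [|split; [|split; [|split]]].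
  - apply total_curvature_pospart; [exact Mm|]; exists a', b'; auto.
  - intros t [Ht|<-]; [|rewrite G0; lra].
    rewrite GK by exact Ht.
    assert (Hf := Hpos t Ht); fold f in Hf; assert (Hu := upos t).
    assert (0 <= phi t / (f t * f t * u t)); [|lra].
    apply Rle_div_r; [|rewrite Rmult_0_l; apply p0].
    apply Rmult_lt_0_compat; [now apply Rmult_lt_0_compat|exact Hu].
  (* A smooth form of the curvature drop phi / (f^2 u), whose denominator vanishes at 0; it is thus
     integrable on [0, b]. *)
  - set (r := fun t => phi t * / (g t * u t)).
    assert (gune : forall t, g t * u t <> 0).
    { intros t; apply Rmult_integral_contrapositive_currified;
        apply Rgt_not_eq; [apply gpos|apply upos]. }
    assert (Sr : smooth r).
    { apply smooth_mult; [exact Sphi|apply smooth_inv; [exact gune|now apply smooth_mult]]. }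
    assert (Srr : smooth (fun t => r t * r t)) by now apply smooth_mult.
    set (k := / (c1 * c1 * (c1 * c1))).
    assert (Hk : 0 < k) by (apply Rinv_0_lt_compat; now apply Rmult_lt_0_compat).
    assert (Hr : forall t, 0 < t -> r t * r t <= k * (phi t * phi t)).
    { intros t Ht; destruct (Rle_or_lt (t * t) 1) as [Ht1|Ht1].
      - unfold r; rewrite pout by exact Ht1; lra.
      - assert (Hf := fpos1 t ltac:(nra)); assert (Hu := ubd t (Rlt_le _ _ Ht)).
        assert (Hg : c1 * c1 <= g t * u t).
        { rewrite gsq by lra; fold f.
          assert (c1 * c1 <= f t * f t) by (apply Rmult_le_compat; lra).
          rewrite <- (Rmult_1_r (c1 * c1)); apply Rmult_le_compat; lra. }
        assert (Hi : / (g t * u t) <= / (c1 * c1)) by now apply Rinv_le_contravar.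
        assert (Hi0 : 0 < / (g t * u t)) by (apply Rinv_0_lt_compat; lra).
        assert (Hp := p0 t).
        assert (Hrt : 0 <= r t <= phi t * / (c1 * c1)).
        { unfold r; split; [apply Rmult_le_pos; lra|apply Rmult_le_compat_l; lra]. }
        replace (k * (phi t * phi t)) with ((phi t * / (c1 * c1)) * (phi t * / (c1 * c1)))
          by (unfold k; field; lra).
        apply Rmult_le_compat; lra. }
    assert (Spp : smooth (fun t => phi t * phi t)) by now apply smooth_mult.
    destruct (improper_int0_bounded (fun t => r t * r t) (eps * eps / 4)) as (l & Hl & Hle).
    + intros t _; apply Rle_0_sqr.
    + intros t _; now apply smooth_ex_RInt.
    + intros t Ht; apply Rle_trans with (RInt (fun t => scal k (phi t * phi t)) 0 t).
      * apply RInt_le; [exact Ht|now apply smooth_ex_RInt| |].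
        -- apply (@ex_RInt_scal R_NormedModule); now apply smooth_ex_RInt.
        -- intros x Hx; apply Hr; lra.
      * rewrite (@RInt_scal R_CompleteNormedModule) by now apply smooth_ex_RInt.
        apply Rle_trans with (k * eta).
        -- apply Rmult_le_compat_l; [lra|now apply psqr].
        -- replace (eps * eps / 4) with (k * (eps * eps / 4 * (c1 * c1 * (c1 * c1))))
             by (unfold k; field; lra).
           apply Rmult_le_compat_l; lra.
    + exists l; split.
      * apply improper_int0_ext with (2 := Hl); intros t Ht; rewrite GK by exact Ht.
        assert (E : phi t / (f t * f t * u t) = r t).
        { unfold r; destruct (Rle_or_lt (t * t) 1) as [Ht1|Ht1].
          - rewrite pout by exact Ht1; unfold Rdiv; ring.
          - rewrite gsq by lra; reflexivity. }
        rewrite E; ring.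
      * apply Rle_lt_trans with (sqrt ((eps / 2) * (eps / 2))).
        -- apply sqrt_le_1_alt; lra.
        -- rewrite sqrt_square; lra.
  - intros M T.
    (* At t^2 = n + 2 > T^2 the new curvature is at most K - |K| - n <= -n <= M - 1. *)
    destruct (nat_above (Rmax (T * T) (1 - M))) as [n Hn].
    assert (HL := Rmax_l (T * T) (1 - M)); assert (HR := Rmax_r (T * T) (1 - M)).
    assert (Hn0 := pos_INR n).
    specialize (pheight n); simpl in pheight.
    set (t := sqrt (INR n + 2)) in *.
    assert (Ht2 : t * t = INR n + 2) by (apply sqrt_sqrt; lra).
    assert (Ht : 0 < t) by (apply sqrt_lt_R0; lra).
    exists t; split; [nra|].
    rewrite GK by exact Ht.
    assert (Hf := Hpos t Ht); fold f in Hf; assert (Hu := ubd t (Rlt_le _ _ Ht)).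
    assert (Hff : 0 < f t * f t) by now apply Rmult_lt_0_compat.
    assert (HA := Rle_abs (radial_curv Df t)); assert (HA0 := Rabs_pos (radial_curv Df t)).
    assert (Rabs (radial_curv Df t) + INR n <= phi t / (f t * f t * u t)); [|lra].
    apply Rle_div_r; [apply Rmult_lt_0_compat; lra|].
    apply Rle_trans with (2 := pheight).
    replace (2 * (f t * f t) * (Rabs (radial_curv Df t) + INR n))
      with ((Rabs (radial_curv Df t) + INR n) * (f t * f t * 2)) by ring.
    apply Rmult_le_compat_l; [lra|apply Rmult_le_compat_l; lra].
  - rewrite Hcab.
    replace (2 * PI * (a - b) - 2 * PI * (a' - b'))
      with (2 * PI * ((a - a') - (b - b'))) by ring.
    assert (HP := PI_4); assert (HP0 := PI_RGT_0).
    apply Rabs_le_between in Haa, Hbb.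
    (* 2 pi <= 8, and the two errors eps / 32 add up to eps / 16. *)
    apply Rle_lt_trans with (8 * (eps / 16)); [|lra].
    rewrite Rabs_mult, (Rabs_pos_eq (2 * PI)) by lra.
    apply Rmult_le_compat; [lra|apply Rabs_pos|lra|apply Rabs_le; lra].
Qed.
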